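(* Let $q=2^h>2$, let $\Sigma_\infty$ be a hyperplane of $\mathrm{PG}(4,q)$, and let $\mathcal{C}$ be a set of $q^2$ affine points ($\mathcal{C}$-points) together with a set of planes ($\mathcal{C}$-planes) satisfying (A1)–(A4). Let $t_N,t_\infty$ be the two disjoint lines of $\Sigma_\infty$ whose union is the set of plus-points. Then there exist homogeneous coordinates $(x_0,\dots,x_4)$ of $\mathrm{PG}(4,q)$ in which $\Sigma_\infty$ has equation $x_4=0$, and an integer $n$ with $\gcd(n,h)=1$, such that $t_N=\langle(0,0,1,0,0),(0,0,0,1,0)\rangle$, $t_\infty=\langle(1,0,0,0,0),(0,1,0,0,0)\rangle$, and the $q+1$ $\mathcal{C}$-lines are $m_t=\langle(t^{2^n},1,0,0,0),(0,0,t,1,0)\rangle$ for $t\in\mathrm{GF}(q)$, together with $m_\infty=\langle(1,0,0,0,0),(0,0,1,0,0)\rangle$.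
   Context: Affine points are points of $\mathrm{PG}(4,q)\setminus\Sigma_\infty$. Conditions: (A1) each $\mathcal{C}$-plane meets $\mathcal{C}$ in a $q$-arc (q points, no three collinear); (A2) any two distinct $\mathcal{C}$-points lie in a unique $\mathcal{C}$-plane; (A3) every affine point not in $\mathcal{C}$ lies on exactly one $\mathcal{C}$-plane; (A4) every plane meeting $\mathcal{C}$ in at least three points either meets $\mathcal{C}$ in exactly four points or is a $\mathcal{C}$-plane. Under these conditions the $\mathcal{C}$-points and $\mathcal{C}$-planes (incidence by containment) form an affine plane $\mathcal{A}$ of order $q$; all $\mathcal{C}$-planes of a parallel class of $\mathcal{A}$ meet $\Sigma_\infty$ in a common line, called a $\mathcal{C}$-line. For a $\mathcal{C}$-plane $\alpha$, the $q$-arc $\alpha\cap\mathcal{C}$ lies in a unique hyperoval $\mathcal{Q}^+$ of $\alpha$, and the two points of $\mathcal{Q}^+\setminus(\alpha\cap\mathcal{C})$ are the plus-points of $\alpha$; the set of all plus-points is the union of two disjoint lines of $\Sigma_\infty$. *)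

(* Defs.v *)
From HB Require Import structures.
From mathcomp Require Import all_boot all_order all_algebra.
From mathcomp Require Import finmap.

Set Implicit Arguments.
Unset Strict Implicit.
Unset Printing Implicit Defensive.

Import GRing.Theory.
Local Open Scope ring_scope.
Local Open Scope fset_scope.

(* Subspaces of PG(4,q), q = #|F|: linear subspaces of F^5. The projective
   dimension is one less than \dim, and incidence is inclusion (_ <= _)%VS. *)
Definition PG4 (F : finFieldType) := {vspace 'rV[F]_5}.

Definition is_point (F : finFieldType) (U : PG4 F) : Prop := \dim U = 1%N.
Definition is_line (F : finFieldType) (U : PG4 F) : Prop := \dim U = 2%N.
Definition is_plane (F : finFieldType) (U : PG4 F) : Prop := \dim U = 3%N.
Definition is_hyperplane (F : finFieldType) (U : PG4 F) : Prop := \dim U = 4%N.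

Definition is_affine_point (F : finFieldType) (Sigma P : PG4 F) : Prop :=
  is_point P /\ ~~ (P <= Sigma)%VS.

Definition sect (F : finFieldType) (C : {fset {vspace 'rV[F]_5}}) (U : PG4 F) :
  {fset {vspace 'rV[F]_5}} := [fset P in C | (P <= U)%VS].

Definition no_three_collinear (F : finFieldType)
    (A : {fset {vspace 'rV[F]_5}}) : Prop :=
  forall P Q R : PG4 F, P \in A -> Q \in A -> R \in A ->
    P != Q -> P != R -> Q != R ->
    ~ exists l : PG4 F,
        is_line l /\ [/\ (P <= l)%VS, (Q <= l)%VS & (R <= l)%VS].

Definition is_arc (F : finFieldType) (k : nat) (alpha : PG4 F)
    (A : {fset {vspace 'rV[F]_5}}) : Prop :=
  [/\ forall P : PG4 F, P \in A -> is_point P /\ (P <= alpha)%VS,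
      #|` A | = k
    & no_three_collinear A].

Definition is_hyperoval (F : finFieldType) (alpha : PG4 F)
    (A : {fset {vspace 'rV[F]_5}}) : Prop :=
  is_arc (#|F| + 2)%N alpha A.

Definition condA1 (F : finFieldType)
    (C Cplanes : {fset {vspace 'rV[F]_5}}) : Prop :=
  forall alpha : PG4 F, alpha \in Cplanes -> is_arc #|F| alpha (sect C alpha).

Definition condA2 (F : finFieldType)
    (C Cplanes : {fset {vspace 'rV[F]_5}}) : Prop :=
  forall P Q : PG4 F, P \in C -> Q \in C -> P != Q ->
    exists! alpha : PG4 F,
      [/\ alpha \in Cplanes, (P <= alpha)%VS & (Q <= alpha)%VS].

Definition condA3 (F : finFieldType) (Sigma : PG4 F)
    (C Cplanes : {fset {vspace 'rV[F]_5}}) : Prop :=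
  forall P : PG4 F, is_affine_point Sigma P -> P \notin C ->
    exists! alpha : PG4 F, alpha \in Cplanes /\ (P <= alpha)%VS.

Definition condA4 (F : finFieldType)
    (C Cplanes : {fset {vspace 'rV[F]_5}}) : Prop :=
  forall pi : PG4 F, is_plane pi -> (3 <= #|` sect C pi|)%N ->
    #|` sect C pi| = 4%N \/ pi \in Cplanes.

(* Parallelism in the affine plane of C-points and C-planes. *)
Definition Cparallel (F : finFieldType) (C : {fset {vspace 'rV[F]_5}})
    (alpha beta : PG4 F) : Prop :=
  alpha = beta \/
  ~ exists P : PG4 F, [/\ P \in C, (P <= alpha)%VS & (P <= beta)%VS].

Definition is_Cline (F : finFieldType) (Sigma : PG4 F)
    (C Cplanes : {fset {vspace 'rV[F]_5}}) (l : PG4 F) : Prop :=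
  is_line l /\
  exists2 alpha : PG4 F, alpha \in Cplanes &
    forall beta : PG4 F, beta \in Cplanes -> Cparallel C alpha beta ->
      (beta :&: Sigma)%VS = l.

(* The hyperoval through a q-arc is unique for q > 2 even, so quantifying it
   existentially is the same as taking the hyperoval. *)
Definition is_plus_point (F : finFieldType)
    (C Cplanes : {fset {vspace 'rV[F]_5}}) (P : PG4 F) : Prop :=
  exists alpha : PG4 F, exists Q : {fset {vspace 'rV[F]_5}},
    [/\ alpha \in Cplanes, is_hyperoval alpha Q,
        sect C alpha `<=` Q & P \in Q `\` sect C alpha].

Definition vec (F : finFieldType) (e : 5.-tuple 'rV[F]_5)
    (a0 a1 a2 a3 a4 : F) : 'rV[F]_5 :=
  \sum_(i < 5) [:: a0; a1; a2; a3; a4]`_i *: tnth e i.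

Definition join2 (F : finFieldType) (u v : 'rV[F]_5) : PG4 F :=
  <<[:: u; v]>>%VS.

Definition m_line (F : finFieldType) (e : 5.-tuple 'rV[F]_5) (n : nat)
    (t : F) : PG4 F :=
  join2 (vec e (t ^+ (2 ^ n)%N) 1 0 0 0) (vec e 0 0 t 1 0).

Definition m_infty (F : finFieldType) (e : 5.-tuple 'rV[F]_5) : PG4 F :=
  join2 (vec e 1 0 0 0 0) (vec e 0 0 1 0 0).

(* Main.v *)
(* Normalise a linear form phi with kernel Sigma to the value 1 on vectors of
   affine points. In characteristic 2, conditions (A2)-(A4) force the fourth
   point of the plane through three C-points a, b, c in no common C-plane to be
   a + b + c. Hence the C-points form a coset of an additive group G of order
   q^2 in Sigma. A C-plane has exactly two points at infinity that are spanned
   by no element of G, and they are its plus-points. So G meets tN and tinfty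
   trivially, hence is the graph of an additive bijection g from tN to tinfty,
   and every C-plane meets both lines: the C-line of a C-plane containing x in
   tN is <g x, x>. Therefore g maps points to points and is semilinear. Its
   field automorphism is x |-> x^(2^n), and it fixes only 0 and 1 because no
   two nonzero elements of G are proportional, so gcd(n, h) = 1. *)
Require Import Defs.
From HB Require Import structures.
From mathcomp Require Import all_boot all_order all_algebra.
From mathcomp Require Import all_fingroup all_solvable all_field.
From mathcomp Require Import finmap.

Set Implicit Arguments.
Unset Strict Implicit.
Unset Printing Implicit Defensive.

Import GRing.Theory FinRing.Theory.
Local Open Scope fset_scope.
Local Open Scope ring_scope.

(** * Frobenius powers of finite fields *)

Lemma finField_rmorph_Frobenius (p : nat) (F : finFieldType)
    (charFp : p \in [pchar F]) (a : {rmorphism F -> F}) :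
  exists n, forall x, a x = x ^+ (p ^ n).
Proof.
pose L := pPrimeCharType charFp; pose aL : L -> L := a.
have aB : zmod_morphism aL by exact: rmorphB.
have aZ : scalable aL by move=> k x; rewrite /aL rmorphM /= rmorph_nat.
pose aL_additive := GRing.isZmodMorphism.Build L L aL aB.
pose aL_scalable := GRing.isScalable.Build _ L L _ aL aZ.
pose aL_linear : {linear L -> L} := HB.pack aL aL_additive aL_scalable.
have /kAut_to_gal[f galf Df] : kAut 1 {:L} (linfun aL_linear).
  rewrite kAutfE; apply/kHom_monoid_morphism.
  by split=> [|x y]; rewrite !lfunE; [apply: rmorph1 | apply: rmorphM].
have [frob gen_frob Dfrob] := finField_galois_generator (sub1v {:L}%AS).
move: galf; rewrite (eqP gen_frob) => /cycleP[n Df_n]; exists n => x.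
have -> : a x = f x by rewrite -Df ?memvf // lfunE.
rewrite {}Df_n; elim: n x => [|n IHn] x; first by rewrite gal_id.
rewrite expgSr galM ?memvf // IHn Dfrob ?memvf // -exprM expnSr.
by rewrite dimv1 expn1 card_Fp // (pcharf_prime charFp).
Qed.

(* With d = gcd(n, h), an element of order p^d - 1 is fixed by x |-> x^(p^n). *)
Lemma coprime_Frobenius_fixed (p h n : nat) (F : finFieldType) :
    #|F| = (p ^ h)%N ->
    (forall c : F, c ^+ (p ^ n) = c -> c ^+ p = c) ->
  coprime n h.
Proof.
move=> cardF fixF; have q_gt1 := finNzRing_gt1 F; rewrite cardF in q_gt1.
have h_gt0 : (0 < h)%N by case: h q_gt1 {cardF}.
have p_gt1 : (1 < p)%N by move: q_gt1; rewrite -{1}(exp1n h) ltn_exp2r.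
set d := gcdn n h; have d_gt0 : (0 < d)%N by rewrite gcdn_gt0 h_gt0 orbT.
have dvd_pred m : (d %| m -> (p ^ d).-1 %| (p ^ m).-1)%N.
  by case/dvdnP=> k ->; rewrite mulnC expnM dvdn_pred_predX.
have /cyclicP[z gen_z] := field_unit_group_cyclic [set: {unit F}]%G.
pose w := (z ^+ (#|F|.-1 %/ (p ^ d).-1))%g.
have order_z : #[z]%g = #|F|.-1 by rewrite -card_finField_unit gen_z.
have q1_gt0 : (0 < (p ^ h).-1)%N by rewrite -ltnS prednK // ltnW.
have order_w : #[w]%g = (p ^ d).-1.
  have dvd_q : ((p ^ d).-1 %| #|F|.-1)%N by rewrite cardF dvd_pred ?dvdn_gcdr.
  by rewrite orderXdiv order_z ?dvdn_div // divnA // mulKn // cardF.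
have fix_w m : (0 < m)%N -> (val w ^+ m == val w) = ((p ^ d).-1 %| m.-1)%N.
  move=> m_gt0; rewrite -val_unitX val_eqE -{2}(expg1 w) eq_expg_mod_order.
  by rewrite order_w eqn_mod_dvd // subn1.
have fix_n : val w ^+ (p ^ n) = val w.
  by apply/eqP; rewrite fix_w ?expn_gt0 ?(ltnW p_gt1) // dvd_pred ?dvdn_gcdl.
have /eqP := fixF _ fix_n; rewrite fix_w ?(ltnW p_gt1) // => /dvdn_leq.
have p1_gt0 : (0 < p.-1)%N by rewrite -ltnS prednK // ltnW.
move=> /(_ p1_gt0); rewrite -ltnS !prednK ?expn_gt0 ?(ltnW p_gt1) //.
rewrite -[leqRHS]expn1 leq_exp2l // => d_le1.
by rewrite /coprime -/d eqn_leq d_le1.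
Qed.

(** * Vector spaces and semilinear maps *)

Section LmodulePchar2.
Variables (R : nzRingType) (V : lmodType R).
Hypothesis pchar2 : 2 \in [pchar R].
Implicit Types v w : V.

Lemma lmod_addrr_pchar2 v : v + v = 0.
Proof. by rewrite -[v]scale1r -scalerDl addrr_pchar2 // scale0r. Qed.

Lemma lmod_oppr_pchar2 v : - v = v.
Proof. by apply/esym/eqP; rewrite -addr_eq0 lmod_addrr_pchar2. Qed.

Lemma lmod_addKr_pchar2 v : involutive (+%R v).
Proof. by move=> w; rewrite addrA lmod_addrr_pchar2 add0r. Qed.

End LmodulePchar2.

Section SmallSpans.
Variables (F : fieldType) (vT : vectType F).
Implicit Types (u v w : vT) (U W : {vspace vT}).

Lemma vlineZ c v : c != 0 -> <[c *: v]>%VS = <[v]>%VS.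
Proof.
move=> c0; apply/eqP; rewrite eqEsubv -!memvE memvZ ?memv_line //=.
by apply/vlineP; exists c^-1; rewrite scalerA mulVf // scale1r.
Qed.

Lemma dim_gt0P U : reflect (exists2 v, v \in U & v != 0) (0 < \dim U)%N.
Proof.
rewrite lt0n dimv_eq0 -vpick0; apply: (iffP idP) => [U0|[v vU v0]].
  by exists (vpick U); first exact: memv_pick.
by rewrite vpick0; apply: contraNneq v0 => U0; rewrite -memv0 -U0.
Qed.

Lemma scalerIr v : v != 0 -> injective ( *:%R^~ v : F -> vT).
Proof.
move=> v0 x y /eqP; rewrite -subr_eq0 -scalerBl scaler_eq0 (negPf v0) orbF.
by rewrite subr_eq0 => /eqP.
Qed.

Lemma exists_notin_vline U v :
  (1 < \dim U)%N -> exists2 u, u \in U & u \notin <[v]>%VS.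
Proof.
move=> dimU; apply/subvPn; apply: contraL dimU => /dimvS dim_le.
by rewrite -leqNgt (leq_trans dim_le) // dim_vline leq_b1.
Qed.

Lemma dim1_vline U v : \dim U = 1%N -> v \in U -> v != 0 -> U = <[v]>%VS.
Proof.
by move=> U1 vU v0; apply/esym/eqP; rewrite eqEdim -memvE vU dim_vline v0 U1.
Qed.

Lemma span2P u v w :
  reflect (exists x y, w = x *: u + y *: v) (w \in <<[:: u; v]>>%VS).
Proof.
rewrite span_cons span_seq1; apply: (iffP memv_addP) => [[_ /vlineP[x ->]]|].
  by case=> _ /vlineP[y ->] ->; exists x, y.
by case=> x [y ->]; exists (x *: u); rewrite ?memvZ ?memv_line //;
  exists (y *: v); rewrite ?memvZ ?memv_line.
Qed.

Lemma span3P u v w t :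
  reflect (exists x y z, t = x *: u + (y *: v + z *: w))
          (t \in <<[:: u; v; w]>>%VS).
Proof.
rewrite span_cons; apply: (iffP memv_addP) => [[_ /vlineP[x ->]]|].
  by case=> _ /span2P[y [z ->]] ->; exists x, y, z.
case=> x [y [z ->]]; exists (x *: u); first by rewrite memvZ ?memv_line.
by exists (y *: v + z *: w) => //; apply/span2P; exists y, z.
Qed.

Lemma memv_span2l u v : u \in <<[:: u; v]>>%VS.
Proof. by rewrite memv_span ?mem_head. Qed.

Lemma memv_span2r u v : v \in <<[:: u; v]>>%VS.
Proof. by rewrite memv_span ?inE ?eqxx ?orbT. Qed.

Lemma span2C u v : <<[:: u; v]>>%VS = <<[:: v; u]>>%VS.
Proof. by apply: eq_span => w; rewrite !inE orbC. Qed.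

Lemma memv_span2_sub U u v w :
  u \in U -> v \in U -> w \in <<[:: u; v]>>%VS -> w \in U.
Proof. by move=> uU vU /span2P[x [y ->]]; rewrite memvD ?memvZ. Qed.

Lemma span2_normalize u v w : w \in <<[:: u; v]>>%VS -> w != 0 ->
  exists2 c, c != 0 & c *: w = u \/ exists x, c *: w = x *: u + v.
Proof.
case/span2P=> x [y ->]; have [->|y0] := eqVneq y 0.
  rewrite scale0r addr0 scaler_eq0 negb_or => /andP[x0 _].
  by exists x^-1; rewrite ?invr_eq0 // scalerA mulVf // scale1r; left.
exists y^-1; rewrite ?invr_eq0 //; right; exists (y^-1 * x).
by rewrite scalerDr !scalerA mulVf // scale1r.
Qed.

Lemma dim_span2 u v : v != 0 -> u \notin <[v]>%VS -> \dim <<[:: u; v]>> = 2%N.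
Proof.
move=> v0 uv; have : free [:: u; v] by rewrite free_cons span_seq1 uv seq1_free.
by move/eqP.
Qed.

Lemma dim2_span U u v : \dim U = 2%N -> u \in U -> v \in U ->
  v != 0 -> u \notin <[v]>%VS -> U = <<[:: u; v]>>%VS.
Proof.
move=> U2 uU vU v0 uv; apply/esym/eqP; rewrite eqEdim U2 dim_span2 // andbT.
by apply/subvP=> w; apply: memv_span2_sub.
Qed.

Lemma capv0_eq0 U W v : (U :&: W = 0)%VS -> v \in U -> v \in W -> v = 0.
Proof. by move=> UW0 vU vW; apply/eqP; rewrite -memv0 -UW0 memv_cap vU. Qed.

Lemma capv0_addv_inj U W u u' w w' : (U :&: W = 0)%VS ->
    u \in U -> u' \in U -> w \in W -> w' \in W ->
  u + w = u' + w' -> u = u' /\ w = w'.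
Proof.
move=> /directv_addP/directv_add_unique uniqUW uU u'U wW w'W /eqP.
by rewrite uniqUW // => /eqP[].
Qed.

End SmallSpans.

Section Hyperplanes.
Variables (F : fieldType) (vT : vectType F).
Implicit Type S : {vspace vT}.

Lemma rcons_hyperplane_basis n (X : n.-tuple vT) S o :
    basis_of S X -> o \notin S -> (\dim S).+1 = \dim {:vT} ->
  basis_of fullv (rcons X o) /\
  forall v, (v \in S) = (coord [tuple of rcons X o] ord_max v == 0).
Proof.
move=> basisX oS dimS; pose e := [tuple of rcons X o].
have free_e : free e.
  rewrite (perm_free (permEl (perm_rcons _ _))) free_cons (span_basis basisX).
  by rewrite oS (basis_free basisX).
have size_e : size e = \dim {:vT}.
  by rewrite size_tuple -dimS (size_basis basisX).
have basis_e : basis_of fullv e by rewrite basisEfree free_e subvf size_e /=.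
have e_widen (i : 'I_n) : e`_(widen_ord (leqnSn n) i) = X`_i.
  by rewrite nth_rcons size_tuple /= ltn_ord.
split=> // v; apply/idP/eqP => [vS|v0].
  rewrite -(span_basis basisX) in vS; rewrite (coord_span vS) linear_sum /=.
  apply: big1 => i _; rewrite linearZ /= -e_widen coord_free // -val_eqE /=.
  by rewrite (ltn_eqF (ltn_ord i)) mulr0.
rewrite (coord_basis basis_e (memvf v)) big_ord_recr /= v0 scale0r addr0.
apply: rpred_sum => i _; rewrite rpredZ // e_widen.
by rewrite (basis_mem basisX) // mem_nth // size_tuple.
Qed.

Lemma hyperplane_scalar S : (\dim S).+1 = \dim {:vT} ->
  exists phi : {scalar vT}, forall v, (v \in S) = (phi v == 0).
Proof.
move=> dimS; have /subvPn[o _ oS] : ~~ ({:vT} <= S)%VS.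
  by apply/negP => /dimvS; rewrite -dimS ltnn.
have [_ coordS] := rcons_hyperplane_basis (vbasisP S) oS dimS.
by exists (coord [tuple of rcons (vbasis S) o] ord_max : {scalar vT}).
Qed.

End Hyperplanes.

Section Semilinear.
Variables (F : fieldType) (vT wT : vectType F) (U : {vspace vT}) (g : vT -> wT).
Hypothesis gD : {in U &, {morph g : x y / x + y}}.
Hypothesis g_scale : {in U, forall x c, g (c *: x) \in <[g x]>%VS}.

Definition scaling (x : vT) (c : F) : F := coord [tuple g x] 0 (g (c *: x)).

Lemma scalingE x c : x \in U -> g (c *: x) = scaling x c *: g x.
Proof.
move=> xU; have gxc : g (c *: x) \in <<[tuple g x]>>%VS.
  by rewrite span_seq1 g_scale.
by rewrite {1}(coord_span gxc) big_ord1.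
Qed.

Lemma additive_on0 : g 0 = 0.
Proof. by apply: (addIr (g 0)); rewrite -gD ?mem0v // !add0r. Qed.

Hypothesis g_indep :
  {in U &, forall x y, x \notin <[y]>%VS -> g x \notin <[g y]>%VS}.

Lemma indep_neq0 x : x \in U -> x != 0 -> g x != 0.
Proof.
move=> xU x0; have x_free : x \notin <[0]>%VS.
  by apply: contra x0 => /vlineP[k ->]; rewrite scaler0.
by apply: contraNneq (g_indep xU (mem0v U) x_free) => ->; apply: mem0v.
Qed.

Lemma scaling_indep x y c : x \in U -> y \in U -> x != 0 -> y \notin <[x]>%VS ->
  scaling y c = scaling x c.
Proof.
move=> xU yU x0 yx; set d := scaling (x + y) c.
have dxy : d *: (g x + g y) = scaling x c *: g x + scaling y c *: g y.
  by rewrite -gD // -!scalingE ?memvD // scalerDr gD ?memvZ.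
have dE : (d - scaling y c) *: g y = (scaling x c - d) *: g x.
  apply/eqP; rewrite !scalerBl subr_eq addrAC eq_sym subr_eq -dxy.
  by rewrite scalerDr addrC.
have dy : d = scaling y c.
  apply/eqP; rewrite -subr_eq0; apply: contraNT (g_indep yU xU yx) => d0.
  by rewrite -[g y](scalerK d0) dE !memvZ ?memv_line.
apply/eqP; rewrite -dy eq_sym -subr_eq0; move: dE; rewrite -dy subrr scale0r.
by move/esym/eqP; rewrite scaler_eq0 (negPf (indep_neq0 xU x0)) orbF.
Qed.

Hypothesis dimU : (1 < \dim U)%N.

Lemma scaling_const x y c : x \in U -> y \in U -> x != 0 -> y != 0 ->
  scaling y c = scaling x c.
Proof.
move=> xU yU x0 y0.
have [yx|] := boolP (y \in <[x]>%VS); last exact: scaling_indep.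
have [z zU zx] := exists_notin_vline x dimU.
have zy : z \notin <[y]>%VS.
  case/vlineP: yx y0 => k ->; rewrite scaler_eq0 negb_or => /andP[k0 _].
  by rewrite vlineZ.
by rewrite -(scaling_indep c xU zU x0 zx) -(scaling_indep c yU zU y0 zy).
Qed.

(* The algebraic half of the fundamental theorem of projective geometry. *)
Lemma semilinear_rmorphism :
  exists a : {rmorphism F -> F}, {in U, forall x c, g (c *: x) = a c *: g x}.
Proof.
have /dim_gt0P[u uU u0] := ltnW dimU.
pose a := scaling u; have gZ : {in U, forall x c, g (c *: x) = a c *: g x}.
  move=> x xU c; have [->|x0] := eqVneq x 0.
    by rewrite scaler0 additive_on0 scaler0.
  by rewrite scalingE // (scaling_const c uU).
have scale_gu := scalerIr (indep_neq0 uU u0).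
have aB : zmod_morphism a.
  move=> b c; apply: scale_gu; apply/eqP; rewrite scalerBl eq_sym subr_eq.
  by rewrite -!gZ // -gD ?memvZ // -scalerDl subrK.
have aM : monoid_morphism a.
  split=> [|b c]; apply: scale_gu; first by rewrite -gZ // !scale1r.
  by rewrite -scalerA -!gZ ?memvZ // scalerA.
pose a_additive := GRing.isZmodMorphism.Build F F a aB.
pose a_multiplicative := GRing.isMonoidMorphism.Build F F a aM.
by exists (HB.pack a a_additive a_multiplicative : {rmorphism F -> F}).
Qed.

End Semilinear.

Section FiniteSemilinear.
Variables (F : finFieldType) (vT wT : vectType F).
Variables (U : {vspace vT}) (g : vT -> wT).
Hypothesis gD : {in U &, {morph g : x y / x + y}}.
Hypothesis g_scale : {in U, forall x c, g (c *: x) \in <[g x]>%VS}.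
Hypothesis g_inj : {in U &, injective g}.

Lemma inj_indep :
  {in U &, forall x y, x \notin <[y]>%VS -> g x \notin <[g y]>%VS}.
Proof.
move=> x y xU yU; apply: contra => /vlineP[b gx].
have [y0|y0] := eqVneq y 0.
  rewrite y0 (additive_on0 gD) scaler0 -(additive_on0 gD) in gx *.
  by rewrite (g_inj xU (mem0v U) gx) mem0v.
have inj_scaling : injective (scaling g y).
  move=> c d Ecd; have /g_inj : g (c *: y) = g (d *: y).
    by rewrite !(scalingE g_scale) // Ecd.
  by move=> /(_ (memvZ _ yU) (memvZ _ yU))/(scalerIr y0).
have /codomP[c bE] := injF_onto inj_scaling b.
apply/vlineP; exists c; apply: g_inj; rewrite ?memvZ //.
by rewrite (scalingE g_scale) // -bE.
Qed.

Lemma finite_semilinear_rmorphism : (1 < \dim U)%N ->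
  exists a : {rmorphism F -> F}, {in U, forall x c, g (c *: x) = a c *: g x}.
Proof. exact: semilinear_rmorphism gD g_scale inj_indep. Qed.

End FiniteSemilinear.

Definition meets_trivially (F : fieldType) (vT : vectType F) (G : {pred vT})
    (U : {vspace vT}) : Prop :=
  {in U, forall v, v \in G -> v = 0}.

Definition is_additive_graph (F : finFieldType) (n : nat)
    (U W : {vspace 'rV[F]_n}) (G : {set 'rV[F]_n})
    (g : 'rV[F]_n -> 'rV[F]_n) : Prop :=
  [/\ {in U, forall x, g x \in W}, {in U &, {morph g : x y / x + y}},
      {in U &, injective g} & G = [set x + g x | x in U]].

Section FiniteSpaces.
Variables (F : finFieldType) (n : nat).
Local Notation V := 'rV[F]_n.

Lemma lines_not_cover (U : {vspace V}) (A : {set V}) :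
    (1 < \dim U)%N -> (#|A| <= #|F|)%N ->
  exists v, [/\ v \in U, v != 0 & {in A, forall a, v \notin <[a]>%VS}].
Proof.
move=> dimU cardA; pose cover := [set p.1 *: p.2 | p in setX [set~ (0 : F)] A].
have card_cover : (#|cover| <= #|F|.-1 * #|F|)%N.
  apply: leq_trans (leq_imset_card _ _) _; rewrite cardsX cardsC1.
  by rewrite leq_mul.
have /subsetPn[v] : ~~ ([set v in U] \subset 0 |: cover).
  apply: contraTN card_cover => /subset_leq_card.
  rewrite cardsE card_vspace -ltnNge.
  move/(leq_trans (leq_pexp2l _ dimU)) => leq_cover.
  have {leq_cover} := leq_trans (leq_cover _) (leq_card_setU _ _).
  rewrite cards1; have := finNzRing_gt1 F; case: #|F| => [|[|q]] //= _.
  move=> /(_ isT); rewrite -mulnn mulSn !addSn add0n !ltnS.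
  by apply: leq_trans; rewrite ltnS leq_addl.
rewrite !inE negb_or => vU /andP[v0 v_cover]; exists v; split=> // a aA.
apply: contra v_cover => /vlineP[c vE]; apply/imsetP; exists (c, a) => //.
rewrite !inE aA andbT; apply: contra_neq v0 => /= c0.
by rewrite vE c0 scale0r.
Qed.

Section AdditiveGraph.
Variables (U W : {vspace V}) (G : {set V}).
Hypothesis G_zmod : zmod_closed G.
Hypothesis G_sub : {in G, forall v, v \in (U + W)%VS}.
Hypothesis UW0 : (U :&: W = 0)%VS.
Hypothesis W_triv : meets_trivially G W.
Hypothesis cardG : #|G| = #|U|.

Lemma zmod_closed_proj_onto x :
  x \in U -> exists2 v, v \in G & daddv_pi U W v = x.
Proof.
move=> xU; suff /eqP projE : daddv_pi U W @: G == [set y in U].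
  have /imsetP[v Gv ->] : x \in daddv_pi U W @: G by rewrite projE inE.
  by exists v.
rewrite eqEcard cardsE -cardG card_in_imset ?leqnn ?andbT.
  by apply/subsetP=> _ /imsetP[v _ ->]; rewrite inE memv_pi.
move=> v w Gv Gw projE; apply/eqP; rewrite -subr_eq0; apply/eqP/W_triv.
  rewrite -(daddv_pi_add UW0 (G_sub Gv)) -(daddv_pi_add UW0 (G_sub Gw)) projE.
  by rewrite [daddv_pi U W w + _]addrC addrKA memvB // memv_pi.
by have [_ GB] := G_zmod; apply: GB.
Qed.

Lemma zmod_closed_graph :
  meets_trivially G U -> exists g, is_additive_graph U W G g.
Proof.
move=> U_triv; have [G0 GB] := G_zmod.
have GD v w : v \in G -> w \in G -> v + w \in G.
  by move=> Gv Gw; rewrite -[w]opprK -[- w]add0r !GB.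
have graph_ex x : exists y, x \in U -> y \in W /\ x + y \in G.
  have [xU|] := boolP (x \in U); last by exists 0.
  have [v Gv <-] := zmod_closed_proj_onto xU; exists (daddv_pi W U v) => _.
  by rewrite memv_pi daddv_pi_add ?G_sub.
have [g gP] := fin_all_exists graph_ex.
have [gW Gg] : {in U, forall x, g x \in W} /\ {in U, forall x, x + g x \in G}.
  by split=> x /gP[].
have graph_uniq x y : x \in U -> y \in W -> x + y \in G -> y = g x.
  move=> xU yW Gxy; apply/eqP; rewrite -subr_eq0; apply/eqP/W_triv.
    by rewrite memvB ?gW.
  by have := GB _ _ Gxy (Gg x xU); rewrite opprD addrACA subrr add0r.
exists g; split=> // [x y xU yU|x y xU yU Eg|].
- apply/esym/graph_uniq; rewrite ?memvD ?gW //.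
  by rewrite addrACA GD ?Gg.
- apply/eqP; rewrite -subr_eq0; apply/eqP/U_triv; first exact: memvB.
  by have := GB _ _ (Gg x xU) (Gg y yU); rewrite Eg [y + _]addrC addrKA.
apply/setP=> v; apply/idP/imsetP => [Gv|[x xU ->]]; last exact: Gg.
have /memv_addP[x xU [y yW vE]] := G_sub Gv; exists x => //.
by rewrite -(graph_uniq x y) // -vE.
Qed.

End AdditiveGraph.

End FiniteSpaces.

(** * C-points as a coset of a group *)

Section ProjectivePoints.
Variable F : finFieldType.
Local Notation V := 'rV[F]_5.
Implicit Types (u v w : V) (P Q R : PG4 F).

Lemma is_point_vline v : v != 0 -> is_point (<[v]>%VS : PG4 F).
Proof. by rewrite /is_point dim_vline => ->. Qed.

Definition collinear P Q R : Prop :=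
  exists l : PG4 F, is_line l /\ [/\ (P <= l)%VS, (Q <= l)%VS & (R <= l)%VS].

Lemma collinear_vline u v w : v != 0 -> u \notin <[v]>%VS ->
  collinear <[u]>%VS <[v]>%VS <[w]>%VS <-> w \in <<[:: u; v]>>%VS.
Proof.
move=> v0 uv; split=> [[l [l_line []]]|wuv]; rewrite -?memvE.
  by move=> ul vl; rewrite (dim2_span l_line ul vl v0 uv).
exists <<[:: u; v]>>%VS; split; first exact: dim_span2.
by rewrite -!memvE memv_span2l memv_span2r.
Qed.

Lemma no_three_collinear_fset1U P A : no_three_collinear A ->
    (forall Q R, Q \in A -> R \in A -> Q != R -> ~ collinear Q R P) ->
  no_three_collinear (P |` A).
Proof.
move=> A_arc no_secant Q R S; rewrite !in_fset1U.
case/predU1P=> [->|QA]; case/predU1P=> [->|RA]; case/predU1P=> [->|SA];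
  rewrite ?eqxx // => QR QS RS [l [l_line [Ql Rl Sl]]].
- by apply: (no_secant R S) => //; exists l.
- by apply: (no_secant Q S) => //; exists l.
- by apply: (no_secant Q R) => //; exists l.
- by apply: (A_arc Q R S) => //; exists l.
Qed.

Lemma vec_rconsE (u' v' u v w : V) (a0 a1 a2 a3 a4 : F) :
  vec [tuple of rcons [tuple u'; v'; u; v] w] a0 a1 a2 a3 a4 =
  a0 *: u' + (a1 *: v' + (a2 *: u + (a3 *: v + a4 *: w))).
Proof.
by rewrite /vec !big_ord_recl big_ord0 /= !(tnth_nth 0) /= addr0.
Qed.

End ProjectivePoints.

Section CArcs.
Variable F : finFieldType.
Hypothesis pchar2 : 2 \in [pchar F].
Local Notation V := 'rV[F]_5.
Variables (Sigma : PG4 F) (phi : {scalar V}).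
Hypothesis hSigma : is_hyperplane Sigma.
Hypothesis phiP : forall v, (v \in Sigma) = (phi v == 0).
Variables (C Cplanes : {fset {vspace V}}).
Hypothesis hC : forall P : PG4 F, P \in C -> is_affine_point Sigma P.
Hypothesis cardC : #|` C | = (#|F| ^ 2)%N.
Hypothesis hCplanes : forall alpha : PG4 F, alpha \in Cplanes -> is_plane alpha.
Hypothesis hA1 : condA1 C Cplanes.
Hypothesis hA2 : condA2 C Cplanes.
Hypothesis hA3 : condA3 Sigma C Cplanes.
Hypothesis hA4 : condA4 C Cplanes.
Implicit Types (a b c d s v w : V) (alpha beta U : {vspace V}) (x y z : F).

Let q_gt1 : (1 < #|F|)%N := finNzRing_gt1 F.
Let addvv v : v + v = 0. Proof. exact: lmod_addrr_pchar2. Qed.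
Let oppv v : - v = v. Proof. exact: lmod_oppr_pchar2. Qed.
Let addKv v : involutive (+%R v). Proof. exact: lmod_addKr_pchar2. Qed.

Lemma affine_neq0 v : phi v = 1 -> v != 0.
Proof. by apply: contra_eq_neq => ->; rewrite linear0 eq_sym oner_eq0. Qed.

Lemma affine_notin_vline v w :
  phi v = 1 -> phi w = 1 -> v != w -> v \notin <[w]>%VS.
Proof.
move=> phi_v phi_w; apply: contra_neqN => /vlineP[c vE]; move: phi_v.
by rewrite vE linearZ /= phi_w mulr1 => ->; rewrite scale1r.
Qed.

(* An affine point is represented by its only vector on which [phi] is 1. *)
Definition Cvec : {set V} := [set v | (phi v == 1) && (<[v]>%VS \in C)].

Lemma phi_Cvec v : v \in Cvec -> phi v = 1.
Proof. by rewrite inE => /andP[/eqP]. Qed.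

Lemma Cvec_C v : v \in Cvec -> <[v]>%VS \in C.
Proof. by rewrite inE => /andP[]. Qed.

Lemma Cvec_notin_Sigma v : v \in Cvec -> v \notin Sigma.
Proof. by move=> /phi_Cvec phi_v; rewrite phiP phi_v oner_eq0. Qed.

Lemma C_Cvec P : P \in C -> exists2 v, v \in Cvec & P = <[v]>%VS.
Proof.
move=> PC; have [P_point /subvPn[p pP]] := hC PC; rewrite phiP => phi_p.
have p0 : p != 0 by apply: contraNneq phi_p => ->; rewrite linear0.
have PE : P = <[(phi p)^-1 *: p]>%VS.
  by rewrite vlineZ ?invr_eq0 //; apply: dim1_vline.
by exists ((phi p)^-1 *: p) => //; rewrite inE -PE PC linearZ /= mulVf ?eqxx.
Qed.

Lemma Cvec_vline_inj : {in Cvec &, injective (fun v => <[v]>%VS)}.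
Proof.
move=> v w /phi_Cvec phi_v /phi_Cvec phi_w; apply: contra_eq => vw.
apply: contraNneq (affine_notin_vline phi_v phi_w vw) => <-.
exact: memv_line.
Qed.

Lemma Cvec_vline_neq v w :
  v \in Cvec -> w \in Cvec -> v != w -> <[v]>%VS != <[w]>%VS.
Proof. by move=> Cv Cw; apply: contra_neq; apply: Cvec_vline_inj. Qed.

Lemma mem_sect_vline v U : v \in Cvec -> (<[v]>%VS \in sect C U) = (v \in U).
Proof. by move=> /Cvec_C Cv; rewrite !inE /= Cv memvE. Qed.

Lemma infty_notin_sect v U : v \in Sigma -> <[v]>%VS \notin sect C U.
Proof.
by move=> vS; apply/negP; rewrite !inE => /andP[/hC[_]]; rewrite -memvE vS.
Qed.

Lemma sect_Cvec P U : P \in sect C U ->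
  exists v, [/\ v \in Cvec, v \in U & P = <[v]>%VS].
Proof.
move=> PU; have /C_Cvec[v Cv PE] : P \in C.
  by move: PU; rewrite !inE => /andP[].
by exists v; rewrite -(mem_sect_vline U Cv) -PE.
Qed.

Lemma card_sect U : #|` sect C U| = #|[set v in Cvec | v \in U]|.
Proof.
have -> : sect C U = [fset <[v]>%VS | v in [set v in Cvec | v \in U]].
  apply/fsetP=> P; apply/idP/imfsetP => [/sect_Cvec[v [Cv vU ->]]|[v /=]].
    by exists v; rewrite //= inE Cv.
  by rewrite inE => /andP[Cv vU] ->; rewrite mem_sect_vline.
rewrite card_in_imfset /= ?cardE // => v w; rewrite !inE.
by case/andP=> Cv _ /andP[Cw _]; apply: Cvec_vline_inj; rewrite inE.
Qed.

Lemma sect_fullv : sect C fullv = C.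
Proof. by apply/fsetP => P; rewrite !inE subvf andbT. Qed.

Lemma card_Cvec : #|Cvec| = (#|F| ^ 2)%N.
Proof.
rewrite -cardC -sect_fullv card_sect; apply: eq_card => v.
by rewrite [RHS]inE memvf andbT.
Qed.

Lemma card_Cvec_Cplane alpha : alpha \in Cplanes ->
  #|[set v in Cvec | v \in alpha]| = #|F|.
Proof. by move=> Calpha; rewrite -card_sect; case: (hA1 Calpha). Qed.

Lemma exists_Cvec : exists o, o \in Cvec.
Proof. by apply/card_gt0P; rewrite card_Cvec expn_gt0 ltnW. Qed.

Lemma Cplane_Cvec alpha :
  alpha \in Cplanes -> exists2 a, a \in Cvec & a \in alpha.
Proof.
move=> /card_Cvec_Cplane card_alpha.
have /card_gt0P[a] : (0 < #|[set v in Cvec | v \in alpha]|)%N.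
  by rewrite card_alpha ltnW.
by rewrite inE => /andP[]; exists a.
Qed.

Lemma Cvec_outside alpha :
  alpha \in Cplanes -> exists2 a, a \in Cvec & a \notin alpha.
Proof.
move=> /card_Cvec_Cplane card_alpha.
have /subsetPn[a Ca] : ~~ (Cvec \subset [set v in Cvec | v \in alpha]).
  apply/negP => /subset_leq_card; rewrite card_alpha card_Cvec -{2}[#|F|]expn1.
  by rewrite leq_exp2l.
by rewrite inE Ca; exists a.
Qed.

Definition Ccoplanar (s : seq V) : Prop :=
  exists2 alpha, alpha \in Cplanes & all [in alpha] s.

Lemma Ccoplanar_sub (s t : seq V) :
  {subset s <= t} -> Ccoplanar t -> Ccoplanar s.
Proof.
move=> st [alpha Calpha /allP t_alpha]; exists alpha => //.
by apply/allP => v /st/t_alpha.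
Qed.

Lemma Ccoplanar2 a b : a \in Cvec -> b \in Cvec -> Ccoplanar [:: a; b].
Proof.
wlog ab : b / a != b => [two_points Ca Cb|Ca Cb].
  have [<-|] := eqVneq a b; last by move=> ab; apply: two_points.
  have /subsetPn[c Cc] : ~~ (Cvec \subset [set a]).
    apply/negP => /subset_leq_card; rewrite cards1 card_Cvec.
    by rewrite leqNgt -(exp1n 2) ltn_exp2r ?q_gt1.
  rewrite inE eq_sym => ac; apply: Ccoplanar_sub (two_points c ac Ca Cc).
  by move=> v; rewrite !inE orbb => ->.
have [alpha [[Calpha a_alpha b_alpha] _]] :=
  hA2 (Cvec_C Ca) (Cvec_C Cb) (Cvec_vline_neq Ca Cb ab).
by exists alpha; rewrite //= !memvE a_alpha b_alpha.
Qed.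

Lemma affine_vline_point v : phi v = 1 -> is_affine_point Sigma <[v]>%VS.
Proof.
move=> phi_v; split; first exact/is_point_vline/affine_neq0.
by rewrite -memvE phiP phi_v oner_eq0.
Qed.

Lemma Cplane_uniq_notC alpha beta v : alpha \in Cplanes -> beta \in Cplanes ->
  phi v = 1 -> v \notin Cvec -> v \in alpha -> v \in beta -> alpha = beta.
Proof.
move=> Calpha Cbeta phi_v; rewrite inE phi_v eqxx /= => Cv v_alpha v_beta.
have [gamma [_ gammaU]] := hA3 (affine_vline_point phi_v) Cv.
by apply: etrans (esym (gammaU alpha _)) (gammaU beta _); rewrite -!memvE.
Qed.

Lemma Cplane_uniq alpha beta v w : alpha \in Cplanes -> beta \in Cplanes ->
    phi v = 1 -> phi w = 1 -> v != w ->
  v \in alpha -> w \in alpha -> v \in beta -> w \in beta -> alpha = beta.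
Proof.
move=> Calpha Cbeta phi_v phi_w vw v_alpha w_alpha v_beta w_beta.
have [Cv|Cv] := boolP (v \in Cvec).
  have [Cw|Cw] := boolP (w \in Cvec).
    have [gamma [_ gammaU]] :=
      hA2 (Cvec_C Cv) (Cvec_C Cw) (Cvec_vline_neq Cv Cw vw).
    by apply: etrans (esym (gammaU alpha _)) (gammaU beta _); rewrite -!memvE.
  exact: (Cplane_uniq_notC Calpha Cbeta phi_w).
exact: (Cplane_uniq_notC Calpha Cbeta phi_v).
Qed.

Lemma Cvec_secant a b c : a \in Cvec -> b \in Cvec -> c \in Cvec -> a != b ->
  c \in <<[:: a; b]>>%VS -> (c == a) || (c == b).
Proof.
move=> Ca Cb Cc ab c_ab; apply/negPn; rewrite negb_or !(eq_sym c).
apply/negP => /andP[ac bc].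
have [alpha Calpha /and3P[a_alpha b_alpha _]] := Ccoplanar2 Ca Cb.
have c_alpha := memv_span2_sub a_alpha b_alpha c_ab.
have [_ _ no_three] := hA1 Calpha; apply: (no_three <[a]> <[b]> <[c]>)%VS;
  rewrite ?mem_sect_vline ?Cvec_vline_neq //.
by apply/collinear_vline; rewrite ?affine_neq0 ?affine_notin_vline ?phi_Cvec.
Qed.

Lemma Ccoplanar_secants a b c d v : all [in Cvec] [:: a; b; c; d] ->
    uniq [:: a; b; c; d] -> phi v = 1 ->
    v \in <<[:: a; b]>>%VS -> v \in <<[:: c; d]>>%VS ->
  Ccoplanar [:: a; b; c; d].
Proof.
case/and5P=> Ca Cb Cc Cd _ /=; rewrite !inE !negb_or.
move=> /and4P[/and3P[ab ac ad] /andP[bc bd] cd _] phi_v v_ab v_cd.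
have Cv : v \notin Cvec.
  apply/negP => Cv; have := Cvec_secant Ca Cb Cv ab v_ab.
  case/orP: (Cvec_secant Cc Cd Cv cd v_cd) => /eqP ->; rewrite ![_ == a]eq_sym.
    by rewrite ![_ == b]eq_sym (negPf ac) (negPf bc).
  by rewrite ![_ == b]eq_sym (negPf ad) (negPf bd).
have [alpha Calpha /and3P[a_alpha b_alpha _]] := Ccoplanar2 Ca Cb.
have [beta Cbeta /and3P[c_beta d_beta _]] := Ccoplanar2 Cc Cd.
have beta_alpha : beta = alpha.
  apply: (Cplane_uniq_notC Cbeta Calpha phi_v Cv).
    exact: memv_span2_sub v_cd.
  exact: memv_span2_sub v_ab.
by exists alpha; rewrite //= a_alpha b_alpha -beta_alpha c_beta d_beta.
Qed.

Lemma noncoplanar_uniq a b c : all [in Cvec] [:: a; b; c] ->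
  ~ Ccoplanar [:: a; b; c] -> uniq [:: a; b; c].
Proof.
case/and4P=> Ca Cb Cc _ noncop.
have [alpha Calpha cop_ac] := Ccoplanar2 Ca Cc.
have [beta Cbeta cop_bc] := Ccoplanar2 Cb Cc.
rewrite /= !inE !negb_or andbT -andbA.
apply/and3P; split; apply: contra_not_neq noncop.
- by move=> <-; exists alpha; rewrite //=; case/and3P: cop_ac => -> ->.
- by move=> ->; exists beta; rewrite //=; case/and3P: cop_bc => -> ->.
- by move=> ->; exists alpha; rewrite //=; case/and3P: cop_ac => -> ->.
Qed.

(* Unless x = 1, the lines bc and sa meet in an affine point. It is not in C,
   because C-planes meet C in arcs, so by (A3) the C-planes through bc and sa
   coincide. *)
Lemma fourth_point_coef a b c s x y z :
    all [in Cvec] [:: s; a; b; c] -> ~ Ccoplanar [:: a; b; c] ->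
    s \notin [:: a; b; c] -> s = x *: a + (y *: b + z *: c) ->
  x = 1.
Proof.
move=> /[dup] Csabc /andP[Cs Cabc] noncop s_new sE.
have [Ca Cb Cc _] := and4P Cabc.
have /and3P[ab ac bc] : [&& a != b, a != c & b != c].
  by have := noncoplanar_uniq Cabc noncop; rewrite /= !inE negb_or andbT -andbA.
have phi_s : x + (y + z) = 1.
  by move: (phi_Cvec Cs); rewrite sE !linearD !linearZ /= !phi_Cvec // !mulr1.
have [yz0|yz0] := eqVneq (y + z) 0; first by rewrite -phi_s yz0 addr0.
case: noncop; suff : Ccoplanar [:: b; c; s; a].
  by apply: Ccoplanar_sub => w; rewrite !inE => /or3P[] ->; rewrite ?orbT.
pose v := (y + z)^-1 *: (y *: b + z *: c).
apply: (@Ccoplanar_secants _ _ _ _ v).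
- by rewrite /= Cs Ca Cb Cc.
- move: s_new; rewrite /= !inE !negb_or => /and3P[-> sb sc].
  by rewrite bc !(eq_sym b) !(eq_sym c) sb sc ab ac.
- by rewrite linearZ linearD !linearZ /= !phi_Cvec // !mulr1 mulVf.
- apply/span2P; exists ((y + z)^-1 * y), ((y + z)^-1 * z).
  by rewrite /v scalerDr !scalerA.
apply/span2P; exists (y + z)^-1, ((y + z)^-1 * x).
by rewrite -scalerA -scalerDr sE [_ + x *: a]addrC addKv.
Qed.

Lemma span3_plane a b c : all [in Cvec] [:: a; b; c] -> uniq [:: a; b; c] ->
  is_plane (<<[:: a; b; c]>>%VS : PG4 F).
Proof.
case/and4P=> Ca Cb Cc _; rewrite /= !inE negb_or andbT -andbA.
case/and3P=> ab ac bc; suff : free [:: a; b; c] by move/eqP.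
rewrite free_cons free_cons span_seq1 seq1_free affine_neq0 ?phi_Cvec // andbT.
rewrite affine_notin_vline ?phi_Cvec // andbT.
by apply/negP => /(Cvec_secant Cb Cc Ca bc); rewrite (negPf ab) (negPf ac).
Qed.

Lemma fourth_point_add a b c s : all [in Cvec] [:: s; a; b; c] ->
    ~ Ccoplanar [:: a; b; c] -> s \notin [:: a; b; c] ->
    s \in <<[:: a; b; c]>>%VS ->
  s = a + b + c.
Proof.
case/andP=> Cs Cabc noncop s_new /span3P[x [y [z sE]]].
have coef1 u v w k l m : [:: u; v; w] =i [:: a; b; c] ->
    s = k *: u + (l *: v + m *: w) -> k = 1.
  move=> abcE.
  have Cuvw : all [in Cvec] [:: u; v; w] by rewrite (eq_all_r abcE).
  apply: fourth_point_coef; last by rewrite abcE.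
  - exact/andP.
  - by apply: contra_not noncop; apply: Ccoplanar_sub => t; rewrite abcE.
have x1 : x = 1 by apply: coef1 sE.
have y1 : y = 1.
  apply: (@coef1 b a c y x z); last by rewrite addrCA.
  by move=> t; rewrite !inE orbCA.
have z1 : z = 1.
  apply: (@coef1 c a b z x y); last by rewrite addrCA [z *: _ + _]addrC.
  by move=> t; rewrite !inE orbC -orbA.
by rewrite sE x1 y1 z1 !scale1r addrA.
Qed.

Lemma Cvec_add_noncoplanar a b c : all [in Cvec] [:: a; b; c] ->
  ~ Ccoplanar [:: a; b; c] -> a + b + c \in Cvec.
Proof.
move=> Cabc noncop; have uniq_abc := noncoplanar_uniq Cabc noncop.
pose pi := <<[:: a; b; c]>>%VS.
pose abc := [fset <[v]>%VS | v in [:: a; b; c]].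
have card_abc : #|` abc| = 3%N.
  rewrite card_in_imfset /=; first by case/and3P: uniq_abc => /negPf-> /negPf->.
  by move=> v w /(allP Cabc) Cv /(allP Cabc) Cw; apply: Cvec_vline_inj.
have abc_pi : abc `<=` sect C pi.
  apply/fsubsetP => _ /imfsetP[v /= v_abc ->].
  by rewrite mem_sect_vline ?(allP Cabc) ?memv_span.
have [||card_pi|pi_Cplane] := @hA4 pi; first exact: span3_plane.
- by move: (fsubset_leq_card abc_pi); rewrite card_abc.
- have /fsubsetPn[P P_pi P_abc] : ~~ (sect C pi `<=` abc).
    by apply/negP => /fsubset_leq_card; rewrite card_pi card_abc.
  have [s [Cs s_pi PE]] := sect_Cvec P_pi.
  rewrite -(fourth_point_add _ noncop _ s_pi) //=; first by rewrite Cs.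
  by apply: contra P_abc => s_abc; rewrite PE; apply/imfsetP; exists s.
by case: noncop; exists pi => //; apply/allP => v; apply: memv_span.
Qed.

(* If a, b, c lie in a C-plane, then a + b + c = u + t + c with t outside the
   plane and u = a + b + t, and now u, t, c lie in no C-plane. *)
Lemma Cvec_add3 a b c :
  a \in Cvec -> b \in Cvec -> c \in Cvec -> a + b + c \in Cvec.
Proof.
move=> Ca Cb Cc; have [<-|ab] := eqVneq a b; first by rewrite addvv add0r.
have [alpha Calpha /and3P[a_alpha b_alpha _]] := Ccoplanar2 Ca Cb.
have noncop_ab t : t \notin alpha -> ~ Ccoplanar [:: a; b; t].
  move=> t_alpha [beta Cbeta /and4P[a_beta b_beta t_beta _]].
  case/negP: t_alpha; rewrite (@Cplane_uniq alpha beta a b) //; exact: phi_Cvec.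
have [c_alpha|c_alpha] := boolP (c \in alpha); last first.
  by apply: Cvec_add_noncoplanar; [rewrite /= Ca Cb Cc | apply: noncop_ab].
have [t Ct t_alpha] := Cvec_outside Calpha.
set u := a + b + t; have Cu : u \in Cvec.
  by apply: Cvec_add_noncoplanar; [rewrite /= Ca Cb Ct | apply: noncop_ab].
have abcE : a + b + c = u + t + c.
  by rewrite /u -[a + b + t + t]addrA addvv addr0.
rewrite abcE; apply: Cvec_add_noncoplanar; first by rewrite /= Cu Ct Cc.
case=> beta Cbeta /and4P[u_beta t_beta c_beta _].
have abc_alpha : a + b + c \in alpha by rewrite !memvD.
have abc_beta : a + b + c \in beta by rewrite abcE memvD ?(memvD u_beta).
case/negP: t_alpha; rewrite (@Cplane_uniq alpha beta c (a + b + c)) //.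
- exact: phi_Cvec.
- by rewrite !linearD /= !phi_Cvec // addrr_pchar2 ?add0r.
- by rewrite -{1}[c]add0r (inj_eq (addIr c)) eq_sym addr_eq0 oppv.
Qed.

Section Directions.
Variable o : V.
Hypothesis Co : o \in Cvec.

Definition Cdir : {set V} := [set g | o + g \in Cvec].
Implicit Types f g : V.

Lemma Cvec_addE a g : a \in Cvec -> (a + g \in Cvec) = (g \in Cdir).
Proof.
move=> Ca; rewrite [RHS]inE; apply/idP/idP => [Cag|Cog].
  by rewrite -(addKv a g) addrA Cvec_add3.
by rewrite -(addKv o g) addrA Cvec_add3.
Qed.

Lemma Cvec_add_Cdir a b : a \in Cvec -> b \in Cvec -> a + b \in Cdir.
Proof. by move=> Ca Cb; rewrite -(Cvec_addE _ Ca) addKv. Qed.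

Lemma Cdir_zmod_closed : zmod_closed Cdir.
Proof.
split=> [|f g Gf Gg]; first by rewrite inE addr0.
by rewrite oppv inE addrA Cvec_addE //; rewrite inE in Gf.
Qed.

Lemma Cdir_Sigma g : g \in Cdir -> g \in Sigma.
Proof.
rewrite inE phiP => /phi_Cvec/eqP.
by rewrite linearD /= (phi_Cvec Co) -subr_eq0 addrAC subrr add0r.
Qed.

Lemma card_Cdir_sect U a : a \in Cvec -> a \in U ->
  #|[set g in Cdir | g \in U]| = #|` sect C U|.
Proof.
move=> Ca aU; rewrite card_sect -(card_imset _ (addrI a)); apply: eq_card => v.
rewrite [RHS]inE; apply/imsetP/andP => [[g]|[Cv vU]].
  by rewrite inE => /andP[Gg gU] ->; rewrite Cvec_addE // memvD.
by exists (a + v); rewrite ?addKv // inE Cvec_add_Cdir // memvD.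
Qed.

Lemma card_Cdir : #|Cdir| = (#|F| ^ 2)%N.
Proof.
rewrite -cardC -sect_fullv -(card_Cdir_sect Co (memvf o)); apply: eq_card => g.
by rewrite [RHS]inE memvf andbT.
Qed.

Lemma card_Cdir_Cplane alpha : alpha \in Cplanes ->
  #|[set g in Cdir | g \in alpha]| = #|F|.
Proof.
move=> Calpha; have [a Ca a_alpha] := Cplane_Cvec Calpha.
by rewrite (card_Cdir_sect Ca a_alpha) card_sect card_Cvec_Cplane.
Qed.

Lemma Cdir_scale x g :
  g \in Cdir -> x *: g \in Cdir -> x *: g = 0 \/ x *: g = g.
Proof.
move=> Gg Gxg; have [->|g0] := eqVneq g 0; first by left; rewrite scaler0.
have : (o + x *: g == o) || (o + x *: g == o + g).
  apply: Cvec_secant; rewrite ?Cvec_addE //.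
    by rewrite -{1}[o]addr0 (inj_eq (addrI o)) eq_sym.
  apply/span2P; exists (1 - x), x.
  by rewrite scalerDr addrA -scalerDl subrK scale1r.
case/orP=> /eqP; last by move=> /addrI; right.
by rewrite -{2}[o]addr0 => /addrI; left.
Qed.

Lemma plus_point_meets_trivially P :
  is_plus_point C Cplanes P -> meets_trivially Cdir P.
Proof.
case=> alpha [Q [Calpha [Q_points _ Q_arc] sectQ]].
rewrite in_fsetD => /andP[P_sect PQ] w wP Gw; have [//|w0] := eqVneq w 0.
have [P_point P_alpha] := Q_points P PQ.
have PE := dim1_vline P_point wP w0; have w_alpha := subvP P_alpha w wP.
have [a Ca a_alpha] := Cplane_Cvec Calpha.
have Caw : a + w \in Cvec by rewrite Cvec_addE.
have aw_alpha : a + w \in alpha by rewrite memvD.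
have a_aw : a != a + w by rewrite -{1}[a]addr0 (inj_eq (addrI a)) eq_sym.
have in_Q v : v \in Cvec -> v \in alpha -> <[v]>%VS \in Q.
  by move=> Cv v_alpha; apply: (fsubsetP sectQ); rewrite mem_sect_vline.
have vline_neqP v : v \in Cvec -> v \in alpha -> <[v]>%VS != P.
  by move=> Cv v_alpha; apply: contraNneq P_sect => <-; rewrite mem_sect_vline.
case: (Q_arc _ _ _ (in_Q a Ca a_alpha) (in_Q _ Caw aw_alpha) PQ);
  rewrite ?Cvec_vline_neq ?vline_neqP // PE.
apply/collinear_vline; rewrite ?affine_neq0 ?affine_notin_vline ?phi_Cvec //.
by apply/span2P; exists 1, 1; rewrite !scale1r addKv.
Qed.

Lemma plus_line_meets_trivially (t : PG4 F) :
    (forall P, is_point P -> (P <= t)%VS -> is_plus_point C Cplanes P) ->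
  meets_trivially Cdir t.
Proof.
move=> plus_t w wt; have [//|w0] := eqVneq w 0.
have /plus_point_meets_trivially := plus_t _ (is_point_vline w0) wt.
by apply; apply: memv_line.
Qed.

Lemma dim_Cplane_infty alpha :
  alpha \in Cplanes -> \dim (alpha :&: Sigma) = 2%N.
Proof.
move=> Calpha; have [a Ca a_alpha] := Cplane_Cvec Calpha.
have : (\dim Sigma < \dim (alpha + Sigma))%N.
  rewrite (ltn_leqif (dimv_leqif_sup (addvSr _ _))).
  apply: contra (Cvec_notin_Sigma Ca) => /subvP; apply.
  exact: (subvP (addvSl alpha Sigma)).
have := dimvS (subvf (alpha + Sigma)); have := dimv_sum_cap alpha Sigma.
rewrite dimvf hSigma (hCplanes Calpha) => dim_sum dim_le5 dim_gt4.
have dim5 : \dim (alpha + Sigma) = 5%N by apply/anti_leq/andP.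
by move: dim_sum; rewrite dim5 -[(3 + 4)%N]/(5 + 2)%N => /addnI.
Qed.

Lemma Cvec_secant_meets_trivially a b w : a \in Cvec -> b \in Cvec -> a != b ->
    w \in Sigma -> w != 0 -> meets_trivially Cdir <[w]>%VS ->
  w \notin <<[:: a; b]>>%VS.
Proof.
move=> Ca Cb ab wSigma w0 w_triv; apply/negP => /span2P[x [y wE]].
have xy : x = y.
  move: wSigma; rewrite phiP wE linearD !linearZ /= !phi_Cvec // !mulr1.
  by rewrite addr_eq0 oppr_pchar2 // => /eqP.
have y0 : y != 0.
  by apply: contra_neq w0 => y0; rewrite wE xy y0 !scale0r addr0.
have ab_w : a + b \in <[w]>%VS.
  apply/vlineP; exists y^-1.
  by rewrite wE xy -scalerDr scalerA mulVf // scale1r.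
have /eqP := w_triv _ ab_w (Cvec_add_Cdir Ca Cb).
by rewrite addr_eq0 oppv (negPf ab).
Qed.

Lemma Cplane_hyperoval alpha v w : alpha \in Cplanes ->
    v \in (alpha :&: Sigma)%VS -> w \in (alpha :&: Sigma)%VS ->
    v != 0 -> w \notin <[v]>%VS ->
    meets_trivially Cdir <[v]>%VS -> meets_trivially Cdir <[w]>%VS ->
  is_hyperoval alpha (<[w]>%VS |` (<[v]>%VS |` sect C alpha)).
Proof.
rewrite !memv_cap => Calpha /andP[v_alpha vS] /andP[w_alpha wS] v0 wv.
move=> v_triv w_triv.
have w0 : w != 0 by apply: contraNneq wv => ->; apply: mem0v.
have wv_neq : <[w]>%VS != <[v]>%VS.
  by apply: contraNneq wv => <-; apply: memv_line.
have [sect_points card_q sect_arc] := hA1 Calpha.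
have not_secant u Q R :
    u \in Sigma -> u != 0 -> meets_trivially Cdir <[u]>%VS ->
    Q \in sect C alpha -> R \in sect C alpha -> Q != R ->
    ~ collinear Q R <[u]>%VS.
  move=> uS u0 u_triv /sect_Cvec[a [Ca _ ->]] /sect_Cvec[b [Cb _ ->]] ab.
  have {}ab : a != b by apply: contra_neq ab => ->.
  rewrite collinear_vline ?affine_neq0 ?affine_notin_vline ?phi_Cvec //.
  by apply/negP; apply: Cvec_secant_meets_trivially.
have not_infty Q : Q \in sect C alpha -> ~ collinear <[w]>%VS <[v]>%VS Q.
  move=> /sect_Cvec[a [Ca _ ->]]; rewrite collinear_vline // => a_wv.
  by case/negP: (Cvec_notin_Sigma Ca); apply: memv_span2_sub a_wv.
split.
- move=> P; rewrite !in_fset1U => /or3P[/eqP->|/eqP->|/sect_points//].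
    by split; [apply: is_point_vline | rewrite -memvE].
  by split; [apply: is_point_vline | rewrite -memvE].
- rewrite !cardfsU1 !in_fset1U negb_or wv_neq !infty_notin_sect // card_q.
  by rewrite addnA addnC.
apply: no_three_collinear_fset1U.
  by apply: no_three_collinear_fset1U => // Q R; apply: not_secant.
move=> Q R; rewrite !in_fset1U.
case/predU1P=> [->|QA]; case/predU1P=> [->|RA]; rewrite ?eqxx // => QR.
- by case=> l [l_line [vl Rl wl]]; apply: (not_infty R RA); exists l.
- by case=> l [l_line [Ql vl wl]]; apply: (not_infty Q QA); exists l.
- exact: not_secant.
Qed.

(* Together with w, the q - 1 nonzero C-directions in alpha span at most q of
   the q + 1 points of the line alpha :&: Sigma. *)
Lemma exists_meets_trivially alpha w : alpha \in Cplanes ->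
  exists v, [/\ v \in (alpha :&: Sigma)%VS, v != 0, v \notin <[w]>%VS &
                meets_trivially Cdir <[v]>%VS].
Proof.
move=> Calpha; pose G := [set g in Cdir | g \in alpha].
have cardG : (#|w |: G :\ 0%R| <= #|F|)%N.
  have G0 : 0 \in G by rewrite inE mem0v andbT; case: Cdir_zmod_closed.
  rewrite -(card_Cdir_Cplane Calpha) (cardsD1 0 G) G0 cardsU1.
  by rewrite leq_add2r; case: (w \notin _).
have dim_gt1 : (1 < \dim (alpha :&: Sigma))%N by rewrite dim_Cplane_infty.
have [v [vL v0 v_new]] := lines_not_cover dim_gt1 cardG.
exists v; split=> // [|_ /vlineP[c ->] Gcv]; first by rewrite v_new ?setU11.
apply/eqP; apply: contraTT (memv_line v) => cv0.
have c0 : c != 0 by apply: contraNneq cv0 => ->; rewrite scale0r.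
rewrite -(vlineZ v c0) v_new // in_setU1 in_setD1 cv0 inE Gcv memvZ ?orbT //.
by case/memv_capP: vL.
Qed.

Lemma Cplane_two_plus_points alpha : alpha \in Cplanes ->
  exists v w, [/\ v \in (alpha :&: Sigma)%VS, w \in (alpha :&: Sigma)%VS,
    v != 0, w \notin <[v]>%VS &
    is_plus_point C Cplanes <[v]>%VS /\ is_plus_point C Cplanes <[w]>%VS].
Proof.
move=> Calpha; have [v [vL v0 _ v_triv]] := exists_meets_trivially 0 Calpha.
have [w [wL w0 wv w_triv]] := exists_meets_trivially v Calpha.
have hyperoval := Cplane_hyperoval Calpha vL wL v0 wv v_triv w_triv.
exists v, w; split=> //.
have [[_ vS] [_ wS]] := (memv_capP vL, memv_capP wL).
split; exists alpha, (<[w]>%VS |` (<[v]>%VS |` sect C alpha)); split=> //;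
  rewrite ?fsetUA ?fsubsetUr //;
  by rewrite in_fsetD infty_notin_sect //= !inE eqxx ?orbT.
Qed.

Lemma dim_infty_cap_meets_trivially alpha U : alpha \in Cplanes ->
  meets_trivially Cdir U -> (\dim ((alpha :&: Sigma) :&: U) <= 1)%N.
Proof.
move=> Calpha U_triv; rewrite leqNgt; apply/negP => dim_gt1.
have /eqP LU : (alpha :&: Sigma :&: U == alpha :&: Sigma)%VS.
  by rewrite eqEdim capvSl dim_Cplane_infty.
have : [set g in Cdir | g \in alpha] \subset [set 0].
  apply/subsetP => g; rewrite in_set1 inE => /andP[Gg g_alpha].
  suff gU : g \in U by rewrite (U_triv g gU Gg).
  suff : g \in (alpha :&: Sigma :&: U)%VS by case/memv_capP.
  by rewrite LU memv_cap g_alpha Cdir_Sigma.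
move/subset_leq_card; rewrite card_Cdir_Cplane // cards1 leqNgt.
by rewrite q_gt1.
Qed.

(** * The lines of plus-points *)

Section PlusLines.
Variables tN tinfty : PG4 F.
Hypothesis tN_line : is_line tN.
Hypothesis tN_Sigma : (tN <= Sigma)%VS.
Hypothesis tinfty_line : is_line tinfty.
Hypothesis tinfty_Sigma : (tinfty <= Sigma)%VS.
Hypothesis tN_tinfty : (tN :&: tinfty)%VS = 0%VS.
Hypothesis hplus : forall P : PG4 F, is_point P ->
  (is_plus_point C Cplanes P <-> (P <= tN)%VS \/ (P <= tinfty)%VS).

Lemma tN_meets_trivially : meets_trivially Cdir tN.
Proof.
by apply: plus_line_meets_trivially => P P_point PN; apply/hplus; last left.
Qed.

Lemma tinfty_meets_trivially : meets_trivially Cdir tinfty.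
Proof.
by apply: plus_line_meets_trivially => P P_point Pi; apply/hplus; last right.
Qed.

Lemma tN_add_tinfty : (tN + tinfty)%VS = Sigma.
Proof.
apply/eqP; rewrite eqEdim subv_add tN_Sigma tinfty_Sigma.
by rewrite dimv_disjoint_sum // tN_line tinfty_line hSigma.
Qed.

Lemma dim_Cplane_cap alpha : alpha \in Cplanes ->
  \dim (alpha :&: tN) = 1%N /\ \dim (alpha :&: tinfty) = 1%N.
Proof.
move=> Calpha.
have [v [w [vL wL v0 wv [v_plus w_plus]]]] := Cplane_two_plus_points Calpha.
have w0 : w != 0 by apply: contraNneq wv => ->; apply: mem0v.
have capE t : (t <= Sigma)%VS -> (alpha :&: t = (alpha :&: Sigma) :&: t)%VS.
  by move=> tS; rewrite -capvA (capv_idPr tS).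
have not_both t : meets_trivially Cdir t -> v \in t -> w \in t -> False.
  move=> t_triv vt wt; have : (<<[:: w; v]>> <= (alpha :&: Sigma) :&: t)%VS.
    by apply/subvP=> u; apply: memv_span2_sub; rewrite memv_cap ?vL ?wL.
  move=> /dimvS/leq_trans/(_ (dim_infty_cap_meets_trivially Calpha t_triv)).
  by rewrite dim_span2.
have dim_cap1 t u : (t <= Sigma)%VS -> meets_trivially Cdir t ->
    u \in t -> u != 0 -> u \in (alpha :&: Sigma)%VS ->
    \dim (alpha :&: t) = 1%N.
  move=> tS t_triv ut u0 uL; apply/eqP; rewrite eqn_leq capE //.
  rewrite dim_infty_cap_meets_trivially //=.
  by apply/dim_gt0P; exists u; rewrite // memv_cap uL.
have [N_triv i_triv] := (tN_meets_trivially, tinfty_meets_trivially).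
have := (hplus (is_point_vline v0)).1 v_plus.
have := (hplus (is_point_vline w0)).1 w_plus.
rewrite -!memvE => -[wt|wt] [vt|vt].
- by case: (not_both tN).
- by split; [apply: (dim_cap1 tN w) | apply: (dim_cap1 tinfty v)].
- by split; [apply: (dim_cap1 tN v) | apply: (dim_cap1 tinfty w)].
- by case: (not_both tinfty).
Qed.

Lemma exists_Cplane_tN alpha : alpha \in Cplanes ->
  exists v, [/\ v \in tN, v != 0 & v \in alpha].
Proof.
move=> /dim_Cplane_cap[dimN _].
have /dim_gt0P[v /memv_capP[v_alpha vN] v0] : (0 < \dim (alpha :&: tN))%N.
  by rewrite dimN.
by exists v.
Qed.

Lemma Cplane_add_mem alpha v w :
    alpha \in Cplanes -> v \in tN -> w \in tinfty ->
  v + w \in alpha -> v \in alpha /\ w \in alpha.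
Proof.
move=> Calpha vN wi vw_alpha; have [dimN dimi] := dim_Cplane_cap Calpha.
have sumE : (alpha :&: tN + alpha :&: tinfty = alpha :&: Sigma)%VS.
  apply/eqP; rewrite eqEdim subv_add !capvS // dim_Cplane_infty //.
  rewrite dimv_disjoint_sum ?dimN ?dimi //.
  by apply/eqP; rewrite -subv0 -tN_tinfty capvS ?capvSr.
have : v + w \in (alpha :&: tN + alpha :&: tinfty)%VS.
  by rewrite sumE memv_cap vw_alpha -tN_add_tinfty memv_add.
case/memv_addP=> v' /memv_capP[v'_alpha v'N] [w' /memv_capP[w'_alpha w'i]].
by move=> /(capv0_addv_inj tN_tinfty vN v'N wi w'i)[-> ->].
Qed.

Lemma exists_Cdir_graph : exists g : V -> V, is_additive_graph tN tinfty Cdir g.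
Proof.
apply: zmod_closed_graph => //.
- exact: Cdir_zmod_closed.
- by move=> v /Cdir_Sigma; rewrite tN_add_tinfty.
- exact: tinfty_meets_trivially.
- by rewrite card_Cdir card_vspace tN_line.
- exact: tN_meets_trivially.
Qed.

Section Graph.
Variable g : V -> V.
Hypothesis g_graph : is_additive_graph tN tinfty Cdir g.

Let g_tinfty : {in tN, forall v, g v \in tinfty}. Proof. by case: g_graph. Qed.
Let gD : {in tN &, {morph g : v w / v + w}}. Proof. by case: g_graph. Qed.
Let g_inj : {in tN &, injective g}. Proof. by case: g_graph. Qed.
Let Cdir_graph : Cdir = [set v + g v | v in tN]. Proof. by case: g_graph. Qed.

Lemma graph_Cdir v : v \in tN -> v + g v \in Cdir.
Proof. by move=> vN; rewrite Cdir_graph; apply/imsetP; exists v. Qed.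

Lemma graph_inj : {in tN &, injective (fun v => v + g v)}.
Proof.
move=> v w vN wN.
by move=> /(capv0_addv_inj tN_tinfty vN wN (g_tinfty vN) (g_tinfty wN))[].
Qed.

Lemma graph_neq0 v : v \in tN -> v != 0 -> g v != 0.
Proof.
move=> vN; apply: contra_neq => gv0; apply: g_inj; rewrite ?mem0v //.
by rewrite (additive_on0 gD).
Qed.

(* Every u in tN with u + g u in alpha lies in alpha, and there are q such u, as
   many as there are vectors in alpha :&: tN. *)
Lemma graph_Cplane alpha v :
  alpha \in Cplanes -> v \in tN -> v \in alpha -> g v \in alpha.
Proof.
move=> Calpha vN v_alpha; pose A := [set u in tN | u + g u \in alpha].
have cardA : #|A| = #|F|.
  have injA : {in A &, injective (fun u => u + g u)}.
    by move=> u w; rewrite !inE => /andP[uN _] /andP[wN _]; apply: graph_inj.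
  rewrite -(card_Cdir_Cplane Calpha) -(card_in_imset injA); apply: eq_card => w.
  apply/imsetP/idP => [[u]|].
    by rewrite inE => /andP[uN u_alpha] ->; rewrite inE u_alpha graph_Cdir.
  rewrite inE Cdir_graph => /andP[/imsetP[u uN ->] u_alpha].
  by exists u; rewrite // inE uN.
have AE : A = [set u in (alpha :&: tN)%VS].
  apply/eqP; rewrite eqEcard cardA cardsE card_vspace (dim_Cplane_cap Calpha).1.
  rewrite expn1 leqnn andbT; apply/subsetP=> u; rewrite !inE memv_cap.
  case/andP=> uN u_alpha.
  by rewrite uN; have [-> _] := Cplane_add_mem Calpha uN (g_tinfty uN) u_alpha.
have : v \in A by rewrite AE inE memv_cap v_alpha.
by rewrite inE => /andP[_ /(Cplane_add_mem Calpha vN (g_tinfty vN))[]].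
Qed.

Lemma Cplane_through_tN v :
  v \in tN -> exists2 alpha, alpha \in Cplanes & v \in alpha.
Proof.
move=> vN.
have Cov : o + (v + g v) \in Cvec by rewrite Cvec_addE // graph_Cdir.
have [alpha Calpha /and3P[o_alpha ov_alpha _]] := Ccoplanar2 Co Cov.
have vgv_alpha : v + g v \in alpha by rewrite -(addKv o (v + g v)) memvD.
have [v_alpha _] := Cplane_add_mem Calpha vN (g_tinfty vN) vgv_alpha.
by exists alpha.
Qed.

Lemma Cplane_cap_tinfty alpha v : alpha \in Cplanes -> v \in tN -> v != 0 ->
  v \in alpha -> (alpha :&: tinfty)%VS = <[g v]>%VS.
Proof.
move=> Calpha vN v0 v_alpha; apply: dim1_vline; rewrite ?graph_neq0 //.
  by case: (dim_Cplane_cap Calpha).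
by rewrite memv_cap graph_Cplane ?g_tinfty.
Qed.

Lemma graph_scale : {in tN, forall v x, g (x *: v) \in <[g v]>%VS}.
Proof.
move=> v vN x; have [->|v0] := eqVneq v 0; first by rewrite scaler0 memv_line.
have [alpha Calpha v_alpha] := Cplane_through_tN vN.
rewrite -(Cplane_cap_tinfty Calpha vN v0 v_alpha) memv_cap.
by rewrite graph_Cplane ?g_tinfty // memvZ.
Qed.

Definition graph_line (v : V) : PG4 F := join2 (g v) v.

Lemma graph_line_is_line v : v \in tN -> v != 0 -> is_line (graph_line v).
Proof.
move=> vN v0; apply: dim_span2 => //; apply/vlineP => -[x gvE].
case/eqP: (graph_neq0 vN v0); apply: capv0_eq0 tN_tinfty _ (g_tinfty vN).
by rewrite gvE memvZ.
Qed.

Lemma Cplane_infty_graph_line alpha v :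
    alpha \in Cplanes -> v \in tN -> v != 0 -> v \in alpha ->
  (alpha :&: Sigma)%VS = graph_line v.
Proof.
move=> Calpha vN v0 v_alpha; apply/esym/eqP; rewrite eqEdim.
rewrite dim_Cplane_infty // graph_line_is_line // andbT; apply/span_subvP => w.
rewrite !inE => /orP[] /eqP ->; rewrite memv_cap.
  by rewrite graph_Cplane // (subvP tinfty_Sigma) ?g_tinfty.
by rewrite v_alpha (subvP tN_Sigma).
Qed.

Lemma graph_lineZ x v : v \in tN -> v != 0 -> x != 0 ->
  graph_line (x *: v) = graph_line v.
Proof.
move=> vN v0 x0; have xv0 : x *: v != 0 by rewrite scaler_eq0 negb_or x0.
have [alpha Calpha v_alpha] := Cplane_through_tN vN.
rewrite -(Cplane_infty_graph_line Calpha vN v0 v_alpha).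
by rewrite (Cplane_infty_graph_line Calpha _ xv0) ?memvZ.
Qed.

(* For C-vectors a in alpha and b in beta, a + b is the sum of a C-direction in
   beta and one in alpha, because w and v span tN. *)
Lemma Cplanes_meet alpha beta v w : alpha \in Cplanes -> beta \in Cplanes ->
    v \in tN -> v \in alpha -> v != 0 ->
    w \in tN -> w \in beta -> w \notin <[v]>%VS ->
  exists u, [/\ u \in Cvec, u \in alpha & u \in beta].
Proof.
move=> Calpha Cbeta vN v_alpha v0 wN w_beta wv.
have [a Ca a_alpha] := Cplane_Cvec Calpha.
have [b Cb b_beta] := Cplane_Cvec Cbeta.
have := Cvec_add_Cdir Ca Cb; rewrite Cdir_graph => /imsetP[z zN abE].
move: zN abE; rewrite (dim2_span tN_line wN vN v0 wv).
case/span2P=> x [y ->]; set w' := x *: w; set v' := y *: v => abE.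
have [w'N v'N] : w' \in tN /\ v' \in tN by rewrite !memvZ.
have meetE : a + (v' + g v') = b + (w' + g w').
  apply/eqP; rewrite -subr_eq0 oppv addrACA abE gD //.
  by rewrite [v' + g v' + _]addrC [w' + v' + _]addrACA addvv.
exists (a + (v' + g v')); rewrite Cvec_addE ?graph_Cdir //; split=> //.
  by rewrite !memvD ?graph_Cplane // memvZ.
by rewrite meetE !memvD ?graph_Cplane // memvZ.
Qed.

Lemma ClineP l : is_Cline Sigma C Cplanes l <->
  exists v, [/\ v \in tN, v != 0 & l = graph_line v].
Proof.
split=> [[l_line [alpha Calpha l_infty]]|[v [vN v0 ->]]].
  have [v [vN v0 v_alpha]] := exists_Cplane_tN Calpha; exists v; split=> //.
  by rewrite -(l_infty alpha) ?(Cplane_infty_graph_line Calpha vN) //; left.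
split; first exact: graph_line_is_line.
have [alpha Calpha v_alpha] := Cplane_through_tN vN.
exists alpha => // beta Cbeta [<-|disjoint].
  exact: Cplane_infty_graph_line.
have [w [wN w0 w_beta]] := exists_Cplane_tN Cbeta.
have [wv|wv] := boolP (w \in <[v]>%VS).
  rewrite (Cplane_infty_graph_line Cbeta wN w0 w_beta).
  case/vlineP: wv w0 => x ->.
  by rewrite scaler_eq0 negb_or => /andP[x0 _]; apply: graph_lineZ.
have [u [Cu u_alpha u_beta]] :=
  Cplanes_meet Calpha Cbeta vN v_alpha v0 wN w_beta wv.
by case: disjoint; exists <[u]>%VS; rewrite -!memvE Cvec_C.
Qed.

Lemma graph_line_parameters l u v :
    u \in tN -> v \in tN -> u != 0 -> v \notin <[u]>%VS ->
  (exists w, [/\ w \in tN, w != 0 & l = graph_line w]) <->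
  (exists x, l = graph_line (x *: u + v)) \/ l = graph_line u.
Proof.
move=> uN vN u0 vu; split=> [[w [wN w0 ->]]|[[x ->]|->]].
- rewrite (dim2_span tN_line vN uN u0 vu) span2C in wN.
  have [c c0 wE] := span2_normalize wN w0.
  rewrite -(graph_lineZ _ w0 c0); last exact: memv_span2_sub wN.
  by case: wE => [->|[x ->]]; [right | left; exists x].
- exists (x *: u + v); split; rewrite ?memvD ?memvZ //.
  apply: contraNneq vu => /eqP; rewrite addr_eq0 oppv => /eqP <-.
  by rewrite memvZ ?memv_line.
by exists u.
Qed.

Lemma graph_Frobenius :
  exists n, {in tN, forall v x, g (x *: v) = x ^+ (2 ^ n) *: g v}.
Proof.
have dimN : (1 < \dim tN)%N by rewrite tN_line.
have [a gZ] := finite_semilinear_rmorphism gD graph_scale g_inj dimN.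
have [n aE] := finField_rmorph_Frobenius pchar2 a.
by exists n => v vN x; rewrite gZ // aE.
Qed.

Lemma graph_Frobenius_coprime h n : #|F| = (2 ^ h)%N ->
  {in tN, forall v x, g (x *: v) = x ^+ (2 ^ n) *: g v} -> coprime n h.
Proof.
move=> cardF gZ; apply: (coprime_Frobenius_fixed cardF) => x xE.
have /dim_gt0P[v vN v0] : (0 < \dim tN)%N by rewrite tN_line.
have Gxv : x *: (v + g v) \in Cdir.
  by rewrite scalerDr -{2}xE -gZ // graph_Cdir ?memvZ.
have vgv0 : v + g v != 0.
  apply: contra_neq v0 => vgv0; apply: (graph_inj vN (mem0v _)).
  by rewrite vgv0 (additive_on0 gD) addr0.
have [xvgv|xvgv] := Cdir_scale (graph_Cdir vN) Gxv.
  have -> : x = 0 by apply: (scalerIr vgv0); rewrite xvgv scale0r.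
  by rewrite expr0n.
have -> : x = 1 by apply: (scalerIr vgv0); rewrite xvgv scale1r.
by rewrite expr1n.
Qed.

End Graph.

Lemma Cline_normal_form h : #|F| = (2 ^ h)%N ->
  exists u v u' v' n,
    [/\ tN = join2 u v, tinfty = join2 u' v', coprime n h &
        forall l, is_Cline Sigma C Cplanes l <->
          (exists x, l = join2 (x ^+ (2 ^ n) *: u' + v') (x *: u + v)) \/
          l = join2 u' u].
Proof.
move=> cardF; have [g g_graph] := exists_Cdir_graph.
have [n gZ] := graph_Frobenius g_graph.
have [g_tinfty gD g_inj _] := g_graph.
have dimN : (1 < \dim tN)%N by rewrite tN_line.
have /dim_gt0P[u uN u0] := ltnW dimN.
have [v vN vu] := exists_notin_vline u dimN.
have gvu := inj_indep gD (graph_scale g_graph) g_inj vN uN vu.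
exists u, v, (g u), (g v), n; split.
- by rewrite /join2 span2C; apply: dim2_span.
- rewrite /join2 span2C; apply: dim2_span => //; rewrite ?g_tinfty //.
  exact: graph_neq0 g_graph _ uN u0.
- exact: graph_Frobenius_coprime gZ.
move=> l; rewrite (ClineP g_graph).
rewrite (graph_line_parameters g_graph l uN vN u0 vu).
have graph_lineE x : graph_line g (x *: u + v) =
    join2 (x ^+ (2 ^ n) *: g u + g v) (x *: u + v).
  by rewrite /graph_line gD ?memvZ // gZ.
by split=> -[[x ->]|->]; [left; exists x | right | left; exists x | right].
Qed.

End PlusLines.
End Directions.
End CArcs.

Theorem theorem4p11 (h : nat) (F : finFieldType)
    (cardF : #|F| = (2 ^ h)%N) (q_gt2 : (2 < #|F|)%N)
    (Sigma : PG4 F) (hSigma : is_hyperplane Sigma)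
    (C Cplanes : {fset {vspace 'rV[F]_5}})
    (hC : forall P : PG4 F, P \in C -> is_affine_point Sigma P)
    (cardC : #|` C | = (#|F| ^ 2)%N)
    (hCplanes : forall alpha : PG4 F, alpha \in Cplanes -> is_plane alpha)
    (hA1 : condA1 C Cplanes) (hA2 : condA2 C Cplanes)
    (hA3 : condA3 Sigma C Cplanes) (hA4 : condA4 C Cplanes)
    (tN tinfty : PG4 F)
    (htN : is_line tN /\ (tN <= Sigma)%VS)
    (htinfty : is_line tinfty /\ (tinfty <= Sigma)%VS)
    (hdisj : (tN :&: tinfty)%VS = 0%VS)
    (hplus : forall P : PG4 F, is_point P ->
       (is_plus_point C Cplanes P <-> (P <= tN)%VS \/ (P <= tinfty)%VS)) :
  exists (e : 5.-tuple 'rV[F]_5) (n : nat),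
    [/\ basis_of fullv e,
        forall v : 'rV[F]_5, v \in Sigma <-> coord e ord_max v = 0
      & coprime n h] /\
    [/\ tN = join2 (vec e 0 0 1 0 0) (vec e 0 0 0 1 0),
        tinfty = join2 (vec e 1 0 0 0 0) (vec e 0 1 0 0 0)
      & forall l : PG4 F, is_Cline Sigma C Cplanes l <->
          (exists t : F, l = m_line e n t) \/ l = m_infty e].
Proof.
have [[tN_line tN_Sigma] [tinfty_line tinfty_Sigma]] := (htN, htinfty).
have pchar2 : 2 \in [pchar F] := card_finPcharP cardF isT.
have dimSigma : (\dim Sigma).+1 = \dim {:'rV[F]_5} by rewrite hSigma dimvf.
have [phi phiP] := hyperplane_scalar dimSigma.
have [o Co] := exists_Cvec phiP hC cardC.
have [u [v [u' [v' [n [tNE tinftyE n_h Cline]]]]]] :=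
  Cline_normal_form pchar2 hSigma phiP hC cardC hCplanes hA1 hA2 hA3 hA4 Co
    tN_line tN_Sigma tinfty_line tinfty_Sigma hdisj hplus cardF.
have basis_Sigma : basis_of Sigma [tuple u'; v'; u; v].
  have /= spanE := span_cat [:: u'; v'] [:: u; v].
  rewrite basisEdim /= spanE -/(join2 u' v') -/(join2 u v) -tNE -tinftyE addvC.
  by rewrite (tN_add_tinfty hSigma) // subvv hSigma.
have [basis_e Sigma_e] :=
  rcons_hyperplane_basis basis_Sigma (Cvec_notin_Sigma phiP Co) dimSigma.
pose simp_vec := (vec_rconsE, scale0r, scale1r, addr0, add0r).
exists [tuple of rcons [tuple u'; v'; u; v] o], n; split; split=> //.
- by move=> w; rewrite Sigma_e; split=> /eqP.
- by rewrite !simp_vec.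
- by rewrite !simp_vec.
move=> l; rewrite Cline /m_infty !simp_vec.
by split=> -[[x ->]|->]; [left; exists x | right | left; exists x | right];
  rewrite // /m_line !simp_vec.
Qed.
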